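(* Let $k \in \{0,1,\ldots,59\}$ and let $r$ be a positive integer. Then the subsequence $(\mathcal{F}_{10,k+rj})_{j=0}^\infty$ is periodic of length $n = \frac{60}{\gcd(r,60)}$; that is, $\mathcal{F}_{10,k+r(j+n)} = \mathcal{F}_{10,k+rj}$ for all $j \ge 0$. In particular, this period $n$ divides $\pi(10) = 60$, the Pisano period of $(\mathcal{F}_{10,n})_{n=0}^\infty$.
   Context: The Fibonacci numbers are $F_0=0$, $F_1=1$, $F_n=F_{n-1}+F_{n-2}$. $\mathcal{F}_{10,n} \in \{0,1,\ldots,9\}$ is the least nonnegative residue of $F_n$ modulo $10$. The Pisano period $\pi(m)$ is the smallest positive integer $s$ such that $F_s \equiv 0 \pmod m$ and $F_{s+1} \equiv 1 \pmod m$. Here ''periodic of length $n$'' means that shifting the index by $n$ leaves the sequence unchanged; $n$ is not required to be the least such positive integer. *)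

(* Defs.v *)
From mathcomp Require Import all_boot.

Set Implicit Arguments.
Unset Strict Implicit.
Unset Printing Implicit Defensive.

Fixpoint fib (n : nat) : nat :=
  match n with
  | 0 => 0
  | 1 => 1
  | (p.+1 as q).+1 => fib q + fib p
  end.

Definition fibmod (m n : nat) : nat := fib n %% m.

(* The length n need not be the least period. *)
Definition periodic_of_length (T : Type) (u : nat -> T) (n : nat) : Prop :=
  forall j, u (j + n) = u j.

Definition fib_returns (m s : nat) : Prop :=
  fib s = 0 %[mod m] /\ fib s.+1 = 1 %[mod m].

(* pi(m) = s, as a relation: pi(m) is the least positive s at which the pair of
   consecutive residues returns to (0, 1). *)
Definition is_pisano_period (m s : nat) : Prop :=
  [/\ 0 < s, fib_returns m s & forall t, 0 < t -> fib_returns m t -> s <= t].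

Lemma is_pisano_period_uniq (m s t : nat) :
  is_pisano_period m s -> is_pisano_period m t -> s = t.
Proof.
move=> [s_gt0 s_ret s_min] [t_gt0 t_ret t_min].
by apply/eqP; rewrite eqn_leq s_min ?t_min.
Qed.

(* Main.v *)
(** Pairs of consecutive Fibonacci residues are the orbit of (0, 1) under
    (a, b) |-> (b, a + b), so an index at which the orbit is back at its start
    is a period. A finite computation shows that the first return modulo 10 is
    at index 60, and r * (60 / gcd(r, 60)) is a multiple of 60. *)

Require Import Defs.
From mathcomp Require Import all_boot.

(** Reducing at every step keeps the unary numbers small when iterating. *)
Definition fib_step (m : nat) (p : nat * nat) : nat * nat :=
  (p.2, (p.1 + p.2) %% m).

(** The start is [1 %% m] rather than [1] so that [fib_pairE] also covers [m = 1]. *)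
Definition fib_pair (m n : nat) : nat * nat :=
  iter n (fib_step m) (0, 1 %% m).

Lemma fib_pairE m n : fib_pair m n = (fibmod m n, fibmod m n.+1).
Proof.
elim: n => [|n IHn]; first by rewrite /fibmod mod0n.
by rewrite /fib_pair iterS -/(fib_pair m n) IHn /fib_step /fibmod /= modnDm addnC.
Qed.

(** Makes returns decidable by computation on pairs, without evaluating [fib]. *)
Lemma fib_returnsP m s : fib_returns m s <-> fib_pair m s = fib_pair m 0.
Proof.
rewrite fib_pairE /fib_pair /fib_returns /fibmod mod0n.
by split=> [[-> ->] | [-> ->]].
Qed.

Lemma fibmod_periodic m s : fib_returns m s -> periodic_of_length (fibmod m) s.
Proof.
move=> /fib_returnsP s_ret n.
have: fib_pair m (n + s) = fib_pair m n.
  by rewrite /fib_pair iterD -/(fib_pair m s) s_ret.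
by rewrite !fib_pairE => -[].
Qed.

Lemma periodic_of_length_mull T (u : nat -> T) n q :
  periodic_of_length u n -> periodic_of_length u (q * n).
Proof.
move=> u_per j; elim: q => [|q IHq]; first by rewrite addn0.
by rewrite mulSn addnCA addnC u_per.
Qed.

Lemma pisano_period_10 : is_pisano_period 10 60.
Proof.
split=> [||t t_gt0 /fib_returnsP t_ret]; first by [].
  (* [done] would try to normalise [fib 60] in unary. *)
  by apply: (proj2 (fib_returnsP 10 60)); vm_compute.
have no_return : all (fun t => fib_pair 10 t != fib_pair 10 0) (iota 1 59).
  by vm_compute.
rewrite leqNgt; apply/negP => t_lt60.
by move/allP/(_ t): no_return; rewrite mem_iota t_gt0 t_lt60 t_ret eqxx => /(_ isT).
Qed.

Theorem corollary2p10 (k r : nat) (hk : k < 60) (hr : 0 < r) :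
  periodic_of_length (fun j => fibmod 10 (k + r * j)) (60 %/ gcdn r 60)
  /\ is_pisano_period 10 60
  /\ 60 %/ gcdn r 60 %| 60.
Proof.
split; last by split; [exact: pisano_period_10 | exact/dvdn_div/dvdn_gcdr].
move=> j; have [_ ret60 _] := pisano_period_10.
(* The index shift [r * (60 %/ gcdn r 60)] becomes [(r %/ gcdn r 60) * 60], a multiple of the
   period. *)
rewrite mulnDr addnA muln_divCA_gcd [60 * _]mulnC.
exact: (periodic_of_length_mull _ _ _ _ (fibmod_periodic _ _ ret60)).
Qed.
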